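(* Let $H$ be a nonzero complex Hilbert space and let $V\subseteq\{\xi\in H:\|\xi\|=1\}$ be a norm-closed set satisfying V1: $\lambda\cdot V\subseteq V$ for every $\lambda\in\mathbb C$ with $|\lambda|=1$; and V2: for $\xi\in H$, if $\langle\xi,\eta\rangle=0$ for all $\eta\in V$ then $\xi=0$. Let $\xi$ be a unit vector in $H$ and let $\omega$ be the corresponding vector state $\omega(X)=\langle X\xi,\xi\rangle$, $X\in\mathcal B(H)$. Then $$E(\omega)=(\|\xi\|^V)^2 .$$ Assuming further that $r(V)>0$, $\omega$ is maximally entangled if and only if $\xi$ is a maximal vector. More generally (still assuming $r(V)>0$), let $\rho$ be an arbitrary maximally entangled normal state, and decompose $\rho$ into a perhaps infinite convex combination of vector states $$\rho=t_1\cdot\omega_1+t_2\cdot\omega_2+\cdots$$ where the $t_k$ are positive numbers with sum $1$ and each $\omega_k$ has the form $\omega_k(X)=\langle X\xi_k,\xi_k\rangle$, $X\in\mathcal B(H)$, with $\|\xi_k\|=1$. Then each $\omega_k$ is maximally entangled.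
   Context: For $\xi\in H$: $\|\xi\|_V=\sup_{\eta\in V}|\langle\xi,\eta\rangle|$; $\|\xi\|^V=\sup\{|\langle\xi,\eta\rangle|:\eta\in H,\ \|\eta\|_V\le1\}\in[0,+\infty]$; $d(\xi,V)=\inf\{\|\xi-\eta\|:\eta\in V\}$. A maximal vector is a unit vector $\xi$ with $d(\xi,V)=\sup_{\|\eta\|=1}d(\eta,V)$. The inner radius $r(V)$ is the largest $r\ge0$ such that $\{\xi\in H:\|\xi\|\le r\}$ is contained in the closed convex hull of $V$. Let $\mathcal K$ be the compact operators on $H$ and $\mathcal A=\{K+\lambda\mathbf 1:K\in\mathcal K,\ \lambda\in\mathbb C\}$. For $X\in\mathcal B(H)$ let $\|X\|_V=\sup_{\xi,\eta\in V}|\langle X\xi,\eta\rangle|$, and for a normal linear functional $\rho$ on $\mathcal B(H)$ define $E(\rho)=\sup\{|\rho(X)|:X\in\mathcal A,\ \|X\|_V\le1\}\in[0,+\infty]$. A normal state $\rho$ is maximally entangled if $E(\rho)=r(V)^{-2}$. *)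

(* Defs.v *)
(* MathComp-Analysis, with complex scalars R[i] over an arbitrary R : realType. *)
From HB Require Import structures.
From mathcomp Require Import all_boot all_order all_algebra.
From mathcomp Require Import all_classical all_reals all_analysis.
From mathcomp Require Export complex.

Set Implicit Arguments.
Unset Strict Implicit.
Unset Printing Implicit Defensive.

Import Order.TTheory GRing.Theory Num.Theory.
Export numFieldNormedType.Exports.

Local Open Scope classical_set_scope.
Local Open Scope complex_scope.
Local Open Scope ring_scope.

#[non_forgetful_inheritance]
HB.instance Definition _ (R : realType) := NormedModule.copy R[i] R[i]^o.

(* The inner product is linear in its first argument. *)
HB.mixin Record CompleteNormedModule_isHilbert (R : realType) H
    & CompleteNormedModule R[i] H := {
  inner : H -> H -> R[i];
  innerDl : forall x y z, inner (x + y) z = inner x z + inner y z;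
  innerZl : forall (a : R[i]) x y, inner (a *: x) y = a * inner x y;
  innerC : forall x y, inner x y = (inner y x)^*;
  inner_norm : forall x : H, inner x x = `|x| ^+ 2
}.

#[short(type="hilbertType")]
HB.structure Definition Hilbert (R : realType) :=
  {H of CompleteNormedModule R[i] H & CompleteNormedModule_isHilbert R H}.

(* Over R[i], the library's norm takes values in the nonnegative reals of R[i];
   rnorm is the same number as an element of R. *)
Definition rnorm (R : realType) (E : normedModType R[i]) (x : E) : R :=
  complex.Re `|x|.

Section BoundedOperators.
Context {R : realType} {H : hilbertType R}.

Definition bounded_op : {pred H -> H} :=
  mem [set f : H -> H | linear f /\ continuous f].

Record bop := Bop { bop_fun :> H -> H ; bopP : bop_fun \in bounded_op }.

HB.instance Definition _ := [isSub for bop_fun].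
HB.instance Definition _ := [Choice of bop by <:].

Lemma bounded_op_submod_closed : submod_closed bounded_op.
Proof.
split=> [|a f g].
  rewrite inE; split=> [a x y|x]; first by rewrite /= scaler0 addr0.
  exact: cst_continuous.
rewrite !inE => -[lf cf] [lg cg]; split=> [b x y|x].
  have -> (z : H) : (a *: f + g) z = a *: f z + g z by [].
  by rewrite lf lg !scalerDr !scalerA mulrC addrACA.
apply: (@cvgD _ _ _ _ _ (a \*: f) g); last exact: cg.
by apply: cvgZl_tmp; exact: cf.
Qed.

HB.instance Definition _ :=
  GRing.isSubmodClosed.Build _ _ bounded_op bounded_op_submod_closed.
HB.instance Definition _ := [SubChoice_isSubLmodule of bop by <:].

Lemma id_bounded_op : idfun \in bounded_op.
Proof. by rewrite inE; split=> // x; exact: cvg_id. Qed.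

Definition id_bop : bop := Bop id_bounded_op.

End BoundedOperators.
Arguments bop {R} H.

Section Entanglement.
Context {R : realType} {H : hilbertType R}.
Implicit Types (V : set H) (x : H) (X : bop H) (rho : bop H -> R[i]).

Definition compact_op X := precompact [set X x | x in [set x | rnorm x <= 1]].

Definition compacts_plus_scalars : set (bop H) :=
  [set X | exists (K : bop H) (l : R[i]), compact_op K /\ X = K + l *: id_bop].

Definition square_summable : set (H ^nat) :=
  [set u | cvgn (series (fun k => rnorm (u k) ^+ 2))].

(* The ultraweak topology on B(H) is the coarsest topology making all the
   functionals X |-> \sum_k <X u_k, v_k>, with u and v square-summable,
   continuous. *)
Definition ultraweak_coordinates X :
    prod_topology (fun _ : square_summable `*` square_summable => R[i]) :=
  fun uv => limn (series (fun k => inner (X ((val uv).1 k)) ((val uv).2 k))).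

Definition ultraweak := initial_topology ultraweak_coordinates.

Definition normal_functional rho :=
  scalar rho /\ continuous (rho : ultraweak -> R[i]).

Definition positive_functional rho :=
  forall X, (forall x, 0 <= inner (X x) x) -> 0 <= rho X.

Definition normal_state rho :=
  [/\ normal_functional rho, positive_functional rho & rho id_bop = 1].

Definition vector_state x : bop H -> R[i] := fun X => inner (X x) x.

Local Open Scope ereal_scope.

(* ||x||_V *)
Definition snorm V x : \bar R :=
  ereal_sup [set (rnorm (inner x y))%:E | y in V].

(* ||x||^V *)
Definition dual_norm V x : \bar R :=
  ereal_sup [set (rnorm (inner x y))%:E | y in [set y | snorm V y <= 1]].

Definition dist V x : \bar R := ereal_inf [set (rnorm (x - y))%:E | y in V].

Definition maximal_vector V x :=
  rnorm x = 1%R /\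
  dist V x = ereal_sup [set dist V y | y in [set y | rnorm y = 1%R]].

Definition closed_convex_hull V : set H :=
  smallest [set A | closed A /\ convex_set A] V.

Definition inner_radius V : R :=
  sup [set r | 0 <= r /\
    [set x | rnorm x <= r] `<=` closed_convex_hull V]%R.

(* ||X||_V *)
Definition op_snorm V X : \bar R :=
  ereal_sup [set (rnorm (inner (X x) y))%:E | x in V & y in V].

Definition entanglement V rho : \bar R :=
  ereal_sup [set (rnorm (rho X))%:E |
    X in compacts_plus_scalars `&` [set X | op_snorm V X <= 1]].

(* The inverse is the one of \bar R, so that 0^-1 = +oo. *)
Definition maximally_entangled V rho :=
  normal_state rho /\ entanglement V rho = (inner_radius V)%:E^-1 ^+ 2.

End Entanglement.

(* Main.v *)
(* Since V is circled, separation of a point from the closed convex hull of V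
   gives the bipolar relation: ||x||^V <= b iff x lies in b times the hull. An
   operator X with ||X||_V <= 1 satisfies |<Xx, y>| <= 1 for all x, y in the hull,
   so E(omega_x) <= (||x||^V)^2; the rank-one operators z |-> <z, y> y with
   ||y||_V <= 1 give the reverse inequality. By the same duality r(V) is the
   infimum of ||.||_V on the unit sphere, and for unit x each of
   "x is maximal", "||x||_V = r(V)" and "||x||^V = r(V)^-1" is equivalent to the
   others. For a mixture, E(rho) <= \sum_j t_j E(omega_j) with E(omega_j) <= r(V)^-2
   for every j, so equality forces E(omega_k) = r(V)^-2. *)
Require Import Defs.
From HB Require Import structures.
From mathcomp Require Import all_boot all_order all_algebra.
From mathcomp Require Import all_classical all_reals all_analysis.
From mathcomp Require Import ring lra.

Set Implicit Arguments.
Unset Strict Implicit.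
Unset Printing Implicit Defensive.

Import Order.TTheory GRing.Theory Num.Theory.

Local Open Scope classical_set_scope.
Local Open Scope complex_scope.
Local Open Scope ring_scope.

(** * Real-valued norms over complex scalars *)

Section RealNorm.
Context {R : realType}.
Implicit Types (E : normedModType R[i]) (z : R[i]).

Lemma normE E (x : E) : `|x| = (rnorm x)%:C.
Proof. by rewrite /rnorm RRe_real// ger0_real. Qed.

Lemma rnorm_ge0 E (x : E) : 0 <= rnorm x.
Proof. by rewrite -ler0c -normE normr_ge0. Qed.

Lemma rnorm0 E : rnorm (0 : E) = 0.
Proof. by rewrite /rnorm normr0. Qed.

Lemma rnorm0_eq0 E (x : E) : rnorm x = 0 -> x = 0.
Proof. by move=> x0; apply/normr0_eq0; rewrite normE x0. Qed.

Lemma rnormN E (x : E) : rnorm (- x) = rnorm x.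
Proof. by rewrite /rnorm normrN. Qed.

Lemma ler_rnormD E (x y : E) : rnorm (x + y) <= rnorm x + rnorm y.
Proof. by rewrite -lecR rmorphD/= -!normE ler_normD. Qed.

Lemma rnormZ E (a : R[i]) (x : E) : rnorm (a *: x) = rnorm a * rnorm x.
Proof.
by apply: complexI; rewrite rmorphM/= -!normE normrZ.
Qed.

Lemma rnormM (a b : R[i]) : rnorm (a * b) = rnorm a * rnorm b.
Proof. by apply: complexI; rewrite rmorphM/= -!normE normrM. Qed.

Lemma rnormR (a : R) : rnorm a%:C = `|a|.
Proof. by rewrite /rnorm normc_def/= expr0n/= addr0 sqrtr_sqr. Qed.

Lemma sqr_rnorm z : rnorm z ^+ 2 = complex.Re z ^+ 2 + complex.Im z ^+ 2.
Proof.
by apply: complexI; rewrite add_Re2_Im2 rmorphXn/=; congr (_ ^+ 2).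
Qed.

Lemma rnormJ z : rnorm (z^*) = rnorm z.
Proof. by rewrite /rnorm normcJ. Qed.

Lemma Re_le_rnorm z : complex.Re z <= rnorm z.
Proof.
rewrite (le_trans (ler_norm _))// -ler_sqr ?nnegrE ?rnorm_ge0//.
by rewrite sqr_rnorm real_normK ?num_real// lerDl sqr_ge0.
Qed.

Lemma ler_rnorm_sum I (r : seq I) (P : pred I) (F : I -> R[i]) :
  rnorm (\sum_(i <- r | P i) F i) <= \sum_(i <- r | P i) rnorm (F i).
Proof.
elim/big_ind2 : _ => // [|x a y b xa yb]; first by rewrite rnorm0.
by rewrite (le_trans (ler_rnormD _ _))// lerD.
Qed.

(** Take the conjugate of [z] divided by its modulus. Bounds on moduli thus reduce to bounds on real
    parts, up to a phase that a circled set absorbs. *)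
Lemma rotate_to_rnorm z : exists2 l : R[i], rnorm l = 1 &
  complex.Re (l * z) = rnorm z.
Proof.
have [->|z0] := eqVneq z 0.
  by exists 1; [rewrite /rnorm normr1|rewrite mulr0 rnorm0].
have nz0 : rnorm z != 0 by apply: contra_neq z0 => /rnorm0_eq0.
have nzC0 : (rnorm z)%:C != 0 by apply: contra_neq nz0 => /complexI.
exists (z^* / (rnorm z)%:C).
  rewrite rnormM rnormJ -fmorphV/= rnormR ger0_norm ?invr_ge0 ?rnorm_ge0//.
  by rewrite divff.
rewrite mulrAC [z^* * z]mulrC -sqr_normc normE expr2 mulfK//.
Qed.

Lemma closed_rnorm_le (T : topologicalType) E (f : T -> E) (c : R) :
  continuous f -> closed [set x | rnorm (f x) <= c].
Proof.
move=> cf p clp /=; rewrite leNgt; apply/negP => cp.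
have e0 : 0 < (rnorm (f p) - c)%:C by rewrite ltcR subr_gt0.
have /cf/clp [x [/= xc]] := nbhsx_ballx (f p) _ e0.
rewrite -ball_normE/= normE ltcR.
move: xc (ler_rnormD (f p - f x) (f x)); rewrite subrK.
lra.
Qed.

Lemma continuous_rnorm_le E (F : normedModType R[i]) (f : E -> F) (c : R) :
  (forall x y, rnorm (f x - f y) <= c * rnorm (x - y)) -> continuous f.
Proof.
move=> fc x; apply/cvgrPdist_le => e e0.
have er : e = (complex.Re e)%:C by rewrite RRe_real// ger0_real ?ltW.
have e'0 : 0 < complex.Re e by rewrite -ltcR -er.
(* [c] carries no sign, so the absolute value plus one serves as a positive Lipschitz constant. *)
have c1 : 0 < `|c| + 1 by rewrite ltr_wpDl.
have d0 : 0 < (complex.Re e / (`|c| + 1))%:C by rewrite ltcR divr_gt0.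
near=> y.
rewrite normE er lecR (le_trans (fc _ _))//.
have : rnorm (x - y) <= complex.Re e / (`|c| + 1).
  rewrite -lecR -normE; near: y.
  by apply: cvgr_dist_le.
rewrite ler_pdivlMr// mulrC; apply: le_trans.
by rewrite ler_wpM2r ?rnorm_ge0// (le_trans (ler_norm _))// lerDl.
Unshelve. all: by end_near. Qed.

Lemma cvg_rnorm (u : R[i]^nat) (l : R[i]) :
  u @ \oo --> l -> rnorm (u n) @[n --> \oo] --> rnorm l.
Proof.
move=> ul; apply/cvgrPdist_le => e e0; near=> n.
have : rnorm (l - u n) <= e.
  rewrite -lecR -normE; near: n.
  by apply: (@cvgr_dist_le _ _ _ _ _ _ _ ul); rewrite ltcR.
have := ler_rnormD (l - u n) (u n); have := ler_rnormD (u n - l) l.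
rewrite !subrK -[rnorm (u n - l)]rnormN opprB ler_norml.
by move=> *; apply/andP; split; lra.
Unshelve. all: by end_near. Qed.

End RealNorm.

(** * Inner product identities and Cauchy-Schwarz *)

Section InnerProduct.
Context {R : realType} {H : hilbertType R}.
Implicit Types (x y z : H) (a : R[i]).

Lemma innerDr x y z : inner x (y + z) = inner x y + inner x z.
Proof. by rewrite innerC innerDl rmorphD/= -!innerC. Qed.

Lemma innerZr a x y : inner x (a *: y) = a^* * inner x y.
Proof. by rewrite innerC innerZl rmorphM/= -innerC. Qed.

Lemma innerNl x y : inner (- x) y = - inner x y.
Proof. by rewrite -scaleN1r innerZl mulN1r. Qed.

Lemma innerNr x y : inner x (- y) = - inner x y.
Proof. by rewrite innerC innerNl rmorphN/= -innerC. Qed.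

Lemma innerBl x y z : inner (x - y) z = inner x z - inner y z.
Proof. by rewrite innerDl innerNl. Qed.

Lemma inner0l y : inner (0 : H) y = 0.
Proof. by rewrite -(scale0r (0 : H)) innerZl mul0r. Qed.

Lemma inner_rnorm x : inner x x = (rnorm x ^+ 2)%:C.
Proof. by rewrite inner_norm normE rmorphXn. Qed.

Lemma rnorm_innerC x y : rnorm (inner x y) = rnorm (inner y x).
Proof. by rewrite innerC rnormJ. Qed.

Lemma Re_innerC x y : complex.Re (inner x y) = complex.Re (inner y x).
Proof. by rewrite innerC; case: inner. Qed.

Lemma sqr_rnormD x y : rnorm (x + y) ^+ 2 =
  rnorm x ^+ 2 + 2 * complex.Re (inner x y) + rnorm y ^+ 2.
Proof.
apply: complexI; rewrite -inner_rnorm innerDl !innerDr !inner_rnorm.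
rewrite addrA -(addrA (_%:C)) (innerC y x) addcJ.
by rewrite !mulr_natl 2!rmorphD rmorphMn.
Qed.

Lemma sqr_rnormB x y : rnorm (x - y) ^+ 2 =
  rnorm x ^+ 2 - 2 * complex.Re (inner x y) + rnorm y ^+ 2.
Proof. by rewrite sqr_rnormD innerNr rnormN raddfN/= mulrN. Qed.

Lemma ReZ (c : R) (z : R[i]) : complex.Re (c%:C * z) = c * complex.Re z.
Proof. by case: z => p q /=; rewrite mul0r subr0. Qed.

Lemma conjcR (c : R) : (c%:C : R[i])^* = c%:C.
Proof. exact: conjc_real. Qed.

(** For nonzero vectors, the square of the norm of [|y| x - |x| y] equals
    [2 |x| |y| (|x| |y| - Re <x, y>)] and is nonnegative. *)
Lemma Re_cauchy_schwarz x y : complex.Re (inner x y) <= rnorm x * rnorm y.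
Proof.
have [y0|y0] := eqVneq (rnorm y) 0.
  by rewrite Re_innerC (rnorm0_eq0 y0) inner0l rnorm0 mulr0.
have [x0|x0] := eqVneq (rnorm x) 0.
  by rewrite (rnorm0_eq0 x0) inner0l rnorm0 mul0r.
have := sqr_ge0 (rnorm ((rnorm y)%:C *: x - (rnorm x)%:C *: y)).
rewrite sqr_rnormB !rnormZ !rnormR !ger0_norm ?rnorm_ge0//.
rewrite innerZl innerZr conjcR !ReZ.
have : 0 < rnorm x by rewrite lt_def x0 rnorm_ge0.
have : 0 < rnorm y by rewrite lt_def y0 rnorm_ge0.
move: (rnorm x) (rnorm y) (complex.Re _) => p q r p0 q0.
have -> : (q * p) ^+ 2 - 2 * (q * (p * r)) + (p * q) ^+ 2 =
  (2 * (p * q)) * (p * q - r) by ring.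
by rewrite pmulr_rge0 ?subr_ge0// !mulr_gt0.
Qed.

Lemma cauchy_schwarz x y : rnorm (inner x y) <= rnorm x * rnorm y.
Proof.
have [l l1 <-] := rotate_to_rnorm (inner x y).
by rewrite -innerZl (le_trans (Re_cauchy_schwarz _ _))// rnormZ l1 mul1r.
Qed.

Lemma continuous_inner y : continuous (fun x => inner x y).
Proof.
apply: (@continuous_rnorm_le _ _ _ _ (rnorm y)) => x z.
by rewrite -innerBl mulrC cauchy_schwarz.
Qed.

Lemma bop_linear (X : bop H) : linear X.
Proof. by have := bopP X; rewrite inE => -[]. Qed.

Lemma continuous_bop (X : bop H) : continuous X.
Proof. by have := bopP X; rewrite inE => -[]. Qed.

End InnerProduct.

(** * Closed convex hulls *)

Section ConvexHull.
Context {R : realType} {H : hilbertType R}.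
Implicit Types (V A : set H) (x y : H).

Lemma sub_hull V : V `<=` closed_convex_hull V.
Proof. exact: sub_smallest. Qed.

Lemma closed_hull V : closed (closed_convex_hull V).
Proof. by apply: closed_bigI => A [[]]. Qed.

Lemma convex_hull V : convex_set (closed_convex_hull V).
Proof.
move=> x y l; rewrite !inE => Vx Vy A [[Ac Av] VA].
have := Av x y l; rewrite !inE; apply; [exact: Vx|exact: Vy].
Qed.

(** The points where [f] has norm at most [c] form a closed convex set containing [V], hence
    containing the smallest such set. *)
Lemma hull_le V (E : normedModType R[i]) (f : H -> E) (c : R) :
    linear f -> continuous f -> (forall v, V v -> rnorm (f v) <= c) ->
  forall x, closed_convex_hull V x -> rnorm (f x) <= c.
Proof.
move=> lf cf fc x /(_ [set x | rnorm (f x) <= c]); apply; split=> //.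
split; first exact: closed_rnorm_le.
move=> y z t; rewrite !inE/= => yc zc.
have t0 : 0 <= t%:num by [].
have t1 : t%:num <= 1 by [].
have -> : conv t y z = t%:num *: (y : H) + (1 - t%:num) *: (z : H) by [].
rewrite lf (GRing.scalable_linear lf).
rewrite (le_trans (ler_rnormD _ _))// !rnormZ.
(* Convexity over [R[i]] uses a complex weight between 0 and 1; such a weight equals its real
   part. *)
have tE : t%:num = (complex.Re t%:num)%:C by rewrite RRe_real// ger0_real.
rewrite tE -[1]/(1%:C) -rmorphB/= !rnormR.
move: t0 t1; rewrite tE ler0c -[1]/(1%:C) lecR; move: (complex.Re _) => u u0 u1.
rewrite !ger0_norm ?subr_ge0//.
have -> : c = u * c + (1 - u) * c by ring.
by rewrite lerD// ler_wpM2l// subr_ge0.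
Qed.

End ConvexHull.

(** * Separation of a point from a bounded closed convex set *)

Section Separation.
Context {R : realType} {H : hilbertType R}.

(* A point c that nearly minimises the distance to x already works as a foot of
   the perpendicular: for c' in A and small t, expanding
   |x - ((1 - t) c + t c')|^2 bounds Re <c' - c, x - c> by d / 2, where d is the
   squared distance from x to A. Completeness is therefore not needed. *)
Lemma separation (A : set H) (M : R) (x : H) :
    closed A -> convex_set A -> A !=set0 -> (forall c, A c -> rnorm c <= M) ->
    ~ A x ->
  exists (y : H) (b : R), (forall c, A c -> complex.Re (inner c y) <= b) /\
    b < complex.Re (inner x y).
Proof.
move=> clA cvA [c0 Ac0] AM nAx.
have [e e0 Ae] : exists2 e : R, 0 < e & forall c, A c -> e <= rnorm (x - c).
  apply: contrapT => noe; apply: nAx; apply: clA => B /nbhs_ballP[r /= r0 rB].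
  have rE : r = (complex.Re r)%:C by rewrite RRe_real// ger0_real ?ltW.
  apply: contrapT => AB0; apply: noe; exists (complex.Re r).
    by rewrite -ltcR -rE.
  move=> c Ac; rewrite leNgt; apply/negP => xc; apply: AB0; exists c; split=> //.
  by apply: rB; rewrite -ball_normE/= normE rE ltcR.
pose S := [set rnorm (x - c) ^+ 2 | c in A].
have Se : lbound S (e ^+ 2).
  by move=> _ [c Ac <-]; rewrite ler_sqr ?nnegrE ?rnorm_ge0 ?Ae// ltW.
have S0 : S !=set0 by exists (rnorm (x - c0) ^+ 2), c0.
have Si : has_inf S by split=> //; exists (e ^+ 2).
have d0 : 0 < inf S by rewrite (lt_le_trans _ (lb_le_inf S0 Se))// exprn_gt0.
move: (inf S) (ge_inf Si.2) (fun e e0 => @inf_adherent _ S e e0 Si) d0.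
move=> d dS Sd d0.
(* [K] bounds the squared distance between any two points of [A]; adding 1 makes it positive. The
   step [t] below then satisfies [t <= 1] and [t * K <= d / 2]. *)
pose K : R := (2 * M) ^+ 2 + 1.
have K0 : 0 < K by rewrite ltr_wpDl// sqr_ge0.
pose t := d / (2 * (K + d)).
have t0 : 0 < t by rewrite divr_gt0// mulr_gt0// addr_gt0.
have Kd0 : 0 < 2 * (K + d) by rewrite mulr_gt0// addr_gt0.
have t1 : t <= 1 by rewrite ler_pdivrMr// mul1r; lra.
have tK : t * K <= d / 2.
  rewrite /t mulrAC ler_pdivrMr//; have : 0 <= d * d by rewrite mulr_ge0 ?ltW.
  by nra.
(* The excess [t * d / 2] allowed for [c] has the size of the quadratic term of the expansion, so
   dividing by [t] leaves a bound independent of [t]. *)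
have td0 : 0 < t * d / 2 by rewrite divr_gt0// mulr_gt0.
have [_ [c Ac <-] cd] := Sd _ td0.
(* The level lies [d / 2] above the value at [c], whereas [x] lies at least [d] above it. *)
exists (x - c), (complex.Re (inner c (x - c)) + d / 2); split; last first.
  have -> : complex.Re (inner x (x - c)) =
      complex.Re (inner c (x - c)) + rnorm (x - c) ^+ 2.
    have -> : rnorm (x - c) ^+ 2 = complex.Re (inner (x - c) (x - c)).
      by rewrite inner_rnorm.
    by rewrite innerBl raddfB/= [RHS]addrC subrK.
  have : d <= rnorm (x - c) ^+ 2 by apply: dS; exists c.
  lra.
move=> c' Ac'.
have -> : complex.Re (inner c' (x - c)) =
    complex.Re (inner c (x - c)) + complex.Re (inner (x - c) (c' - c)).
  by rewrite (Re_innerC (x - c)) innerBl raddfB/= [RHS]addrC subrK.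
rewrite lerD2l.
have tC0 : 0 <= t%:C by rewrite ler0c ltW.
have tC1 : t%:C <= 1 by rewrite -[1]/(1%:C) lecR.
have At : A (t%:C *: c' + (1 - t%:C) *: c).
  by have := cvA c' c (Itv01 tC0 tC1); rewrite !inE; apply.
have : d <= rnorm (x - (t%:C *: c' + (1 - t%:C) *: c)) ^+ 2.
  by apply: dS; eexists; first exact: At.
have -> : x - (t%:C *: c' + (1 - t%:C) *: c) = (x - c) - t%:C *: (c' - c).
  by rewrite scalerBl scale1r scalerBr addrCA opprD addrA.
rewrite sqr_rnormB innerZr conjcR ReZ rnormZ rnormR (ger0_norm (ltW t0)) exprMn.
have : rnorm (c' - c) ^+ 2 <= K.
  rewrite ler_wpDr// ler_sqr ?nnegrE ?rnorm_ge0//.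
    rewrite (le_trans (ler_rnormD _ _))// rnormN.
    by move: (AM _ Ac) (AM _ Ac'); lra.
  by move: (AM _ Ac) (rnorm_ge0 c); lra.
move: (rnorm (c' - c) ^+ 2) (complex.Re (inner (x - c) (c' - c)))
  (rnorm (x - c) ^+ 2) cd => N q p pd NK.
move=> dp.
have : t * (2 * q) <= t * d.
  have : t ^+ 2 * N <= t * (d / 2).
    rewrite expr2 -mulrA; apply: ler_wpM2l; first exact: ltW.
    by apply: le_trans tK; apply: ler_wpM2l; first exact: ltW.
  lra.
by rewrite ler_pM2l//; lra.
Qed.

End Separation.

(** * Rank-one operators and their compactness *)

Section RankOne.
Context {R : realType} {H : hilbertType R}.
Implicit Types (x y : H).

Lemma rank1_subproof y : (fun x => inner x y *: y) \in bounded_op.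
Proof.
rewrite inE; split=> [a x z|].
  by rewrite innerDl innerZl scalerDl scalerA.
apply: (@continuous_rnorm_le _ _ _ _ (rnorm y * rnorm y)) => x z.
rewrite -scalerBl -innerBl rnormZ mulrAC ler_wpM2r ?rnorm_ge0//.
by rewrite mulrC cauchy_schwarz.
Qed.

Definition rank1 y : bop H := Bop (rank1_subproof y).

Lemma continuous_scale_real y : continuous (fun a : R => a%:C *: y).
Proof.
move=> a; apply/cvgrPdist_le => e e0.
have eE : e = (complex.Re e)%:C by rewrite RRe_real// ger0_real ?ltW.
have e'0 : 0 < complex.Re e by rewrite -ltcR -eE.
have y1 : 0 < rnorm y + 1 by rewrite ltr_wpDl// rnorm_ge0.
near=> b.
rewrite -scalerBl -rmorphB normE rnormZ rnormR eE lecR.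
have : `|a - b| <= complex.Re e / (rnorm y + 1).
  by near: b; apply: cvgr_dist_le => //; rewrite divr_gt0.
rewrite ler_pdivlMr//; apply: le_trans.
by rewrite ler_wpM2l// lerDl.
Unshelve. all: by end_near. Qed.

(** The image of the unit ball lies in the complex line through [y], within the continuous image of
    the real square of half-side [|y|], which is compact. *)
Lemma compact_rank1 y : compact_op (rank1 y).
Proof.
pose g (p : R * R) : H := p.1%:C *: y + p.2%:C *: ('i%C *: y).
have gc : continuous g.
  move=> p; apply: (@cvgD _ _ _ _ _ (fun p : R * R => p.1%:C *: y)
      (fun p : R * R => p.2%:C *: ('i%C *: y))).
    by apply: (continuous_comp (@cvg_fst _ _ _ _ _) (@continuous_scale_real y _)).
  by apply: (continuous_comp (@cvg_snd _ _ _ _ _)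
    (@continuous_scale_real ('i%C *: y) _)).
pose M := rnorm y.
apply: (@precompact_subset _ _ (g @` (`[- M, M] `*` `[- M, M]))); last first.
  apply: compact_precompact; first exact: norm_hausdorff.
  apply: continuous_compact; first exact: continuous_subspaceT.
  by apply: compact_setX; apply: segment_compact.
move=> _ [x /= x1 <-].
have xM : rnorm (inner x y) <= M.
  by rewrite (le_trans (cauchy_schwarz _ _))// ler_piMl ?rnorm_ge0.
have M0 : 0 <= M := rnorm_ge0 y.
exists (complex.Re (inner x y), complex.Im (inner x y)); last first.
  by rewrite /g/= scalerA -scalerDl mulrC -complexE.
split=> /=; rewrite in_itv/= -ler_norml (le_trans _ xM)//;
  by rewrite -ler_sqr ?nnegrE ?rnorm_ge0// real_normK ?num_real// sqr_rnorm
    ?lerDl ?lerDr sqr_ge0.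
Qed.

Lemma rank1_compacts_plus_scalars y : compacts_plus_scalars (rank1 y).
Proof.
by exists (rank1 y), 0; split; [exact: compact_rank1|rewrite scale0r addr0].
Qed.

End RankOne.

(** * Vector states are normal *)

Section VectorState.
Context {R : realType} {H : hilbertType R}.
Implicit Types (x y : H).

(** Padding [x] with zeros makes [<X x, x>] one of the series that define the ultraweak topology. *)
Let at0 x : H^nat := fun k => if k == 0%N then x else 0.

Lemma series_at0 (E : zmodType) (u : E^nat) n :
  (forall k, u k.+1 = 0) -> series u n.+1 = u 0%N.
Proof.
by move=> u0; rewrite /series/= big_nat_recl// big1 ?addr0// => i _; exact: u0.
Qed.

Lemma square_summable_at0 x : square_summable (at0 x).
Proof.
apply: (@is_cvg_near_cst _ _ (rnorm x ^+ 2)); near=> n.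
have n0 : (0 < n)%N by near: n; exact: nbhs_infty_gt.
by rewrite -(prednK n0) series_at0// => k; rewrite /at0/= rnorm0 expr0n.
Unshelve. all: by end_near. Qed.

Lemma normal_state_vector_state x :
  rnorm x = 1 -> normal_state (vector_state x).
Proof.
move=> x1; split; last 2 first.
- by move=> X; apply.
- by rewrite /vector_state inner_rnorm x1 expr1n.
split=> [a X Y|].
  by rewrite /vector_state innerDl innerZl.
have xx : (at0 x, at0 x) \in square_summable `*` square_summable.
  by rewrite inE; split; exact: square_summable_at0.
pose i : square_summable `*` square_summable := exist _ (at0 x, at0 x) xx.
(* The partial sums are constant from the first term on, so the coordinate at [i] is the vector
   state itself. *)
have -> : vector_state x = proj i \o ultraweak_coordinates.
  apply/funext => X; rewrite /= /proj /ultraweak_coordinates/=.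
  apply/esym/cvg_lim => //.
  apply: cvg_near_cst; near=> n.
  have n0 : (0 < n)%N by near: n; exact: nbhs_infty_gt.
  by rewrite -(prednK n0) series_at0// => k; rewrite /at0/= innerC inner0l rmorph0.
move=> X; apply: continuous_comp; first exact: initial_continuous.
exact: proj_continuous.
Unshelve. all: by end_near. Qed.

End VectorState.

(** Writes a quantity attached to the single index [k] as a sum over [D], so that it can be
    subtracted term by term from another such sum. *)
Lemma sum_indicator (R : realType) (D : set nat) k n (c : R) : D k -> (k < n)%N ->
  \sum_(0 <= j < n | j \in D) (if j == k then c else 0) = c.
Proof.
move=> Dk kn; rewrite big_mkcond/= (bigD1_seq k) ?mem_index_iota ?iota_uniq//=.
rewrite eqxx mem_set// big1 ?addr0// => j /negPf ->.
by case: ifP.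
Qed.

(** * The norm defined by a circled set of unit vectors *)

Section EntanglingSet.
Context {R : realType} {H : hilbertType R} (V : set H).
Context (H_neq0 : exists x : H, x != 0).
Context (V_unit : forall x, V x -> rnorm x = 1).
Context (V1 : forall (l : R[i]) x, rnorm l = 1 -> V x -> V (l *: x)).
Context (V2 : forall x : H, (forall y, V y -> inner x y = 0) -> x = 0).
Implicit Types (x y z v : H) (X : bop H) (a b c r : R).

Let hull := closed_convex_hull V.

Lemma V_neq0 : V !=set0.
Proof.
have [x x0] := H_neq0; apply: contrapT => V0; move: x0.
by rewrite [x]V2 ?eqxx// => y Vy; case: V0; exists y.
Qed.

Lemma snorm_leP x c : (snorm V x <= c%:E)%E <->
  forall v, V v -> rnorm (inner x v) <= c.
Proof.
split=> [xc v Vv|xc].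
  by rewrite -lee_fin (le_trans _ xc)//; apply: ereal_sup_ubound; exists v.
by apply: ge_ereal_sup => _ [v Vv <-]; rewrite lee_fin xc.
Qed.

Lemma snorm_ge x v : V v -> ((rnorm (inner x v))%:E <= snorm V x)%E.
Proof. by move=> Vv; apply: ereal_sup_ubound; exists v. Qed.

Lemma snorm_ge0 x : (0 <= snorm V x)%E.
Proof.
have [v Vv] := V_neq0; apply: le_trans (snorm_ge x Vv).
by rewrite lee_fin rnorm_ge0.
Qed.

Lemma snorm_le_rnorm x : (snorm V x <= (rnorm x)%:E)%E.
Proof.
apply/snorm_leP => v Vv.
by rewrite (le_trans (cauchy_schwarz _ _))// (V_unit Vv) mulr1.
Qed.

(** The supremum lies between 0 and [|x|], so it is a real number. *)
Lemma snormE x : snorm V x = (fine (snorm V x))%:E.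
Proof.
rewrite fineK// ge0_fin_numE ?snorm_ge0//.
by rewrite (le_lt_trans (snorm_le_rnorm x))// ltry.
Qed.

Lemma snormZ_le x (l : R[i]) c : (snorm V x <= c%:E)%E ->
  (snorm V (l *: x) <= (rnorm l * c)%:E)%E.
Proof.
move=> /snorm_leP xc; apply/snorm_leP => v Vv.
by rewrite innerZl rnormM ler_wpM2l ?rnorm_ge0 ?xc.
Qed.

Lemma hull_rnorm x : hull x -> rnorm x <= 1.
Proof.
have idP : linear (id : H -> H) by [].
move=> hx; apply: (@hull_le _ _ V H id 1 idP _ _ x hx) => [|v /V_unit v1].
  by move=> z; exact: cvg_id.
by rewrite v1.
Qed.

(** A phase times [v] is again in [V], and a suitable phase turns the real part into the modulus. *)
Lemma Re_le_snorm x c :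
    (forall v, V v -> complex.Re (inner v x) <= c) -> (snorm V x <= c%:E)%E.
Proof.
move=> xc; apply/snorm_leP => v Vv; rewrite rnorm_innerC.
have [l l1 <-] := rotate_to_rnorm (inner v x).
by rewrite -innerZl; apply/xc/V1.
Qed.

(** Otherwise a separating vector [y] with level [b] would satisfy [||y||_V <= b], while [Re <x, y>]
    exceeds [b]. *)
Lemma polar_hull x :
    (forall y c, (snorm V y <= c%:E)%E -> rnorm (inner x y) <= c) -> hull x.
Proof.
move=> xP; apply: contrapT => nVx.
have [v0 Vv0] := V_neq0.
have hull0 : hull !=set0 by exists v0; exact: sub_hull.
have [y [b [yb bx]]] :=
  separation (@closed_hull _ _ V) (@convex_hull _ _ V) hull0 hull_rnorm nVx.
have : (snorm V y <= b%:E)%E.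
  by apply: Re_le_snorm => v Vv; apply: yb; exact: sub_hull.
move=> /xP; apply/negP; rewrite -ltNge (lt_le_trans bx)//.
exact: Re_le_rnorm.
Qed.

(** * The dual norm and the hull *)

Lemma dual_norm_ge x y : (snorm V y <= 1)%E ->
  ((rnorm (inner x y))%:E <= dual_norm V x)%E.
Proof. by move=> y1; apply: ereal_sup_ubound; exists y. Qed.

Lemma dual_norm_ge0 x : (0 <= dual_norm V x)%E.
Proof.
rewrite (le_trans _ (@dual_norm_ge x 0 _)) ?lee_fin ?rnorm_ge0//.
by apply: le_trans (snorm_le_rnorm _) _; rewrite rnorm0 lee_fin.
Qed.

(** A unit vector is its own test vector, since [||x||_V <= |x|]. *)
Lemma dual_norm_ge1 x : rnorm x = 1 -> (1 <= dual_norm V x)%E.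
Proof.
move=> x1; apply: le_trans (@dual_norm_ge x x _).
  by rewrite inner_rnorm rnormR x1 expr1n normr1.
by apply: le_trans (snorm_le_rnorm _) _; rewrite x1.
Qed.

Lemma dual_norm_hull x b : 0 < b -> (dual_norm V x <= b%:E)%E ->
  hull ((b^-1)%:C *: x).
Proof.
move=> b0 xb; apply: polar_hull => y c yc.
have c0 : 0 <= c by rewrite -lee_fin (le_trans (snorm_ge0 y)).
rewrite innerZl rnormM rnormR gtr0_norm ?invr_gt0// mulrC ler_pdivrMr//.
(* For [c = 0] the vector [y] is orthogonal to [V], hence zero by [V2]; otherwise [c^-1 y] is
   admissible in the dual norm. *)
have [c00|c00] := eqVneq c 0.
  have -> : y = 0.
    apply: V2 => v Vv; apply/rnorm0_eq0/eqP; rewrite eq_le rnorm_ge0 andbT.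
    by move: yc; rewrite c00 => /snorm_leP; exact.
  by rewrite rnorm_innerC inner0l rnorm0 mulr_ge0// ltW.
have cV0 : 0 < c^-1 by rewrite invr_gt0 lt_def c00.
have : (snorm V ((c^-1)%:C *: y) <= 1)%E.
  by have := snormZ_le (c^-1)%:C yc; rewrite rnormR gtr0_norm// mulVf.
move=> /(dual_norm_ge x)/le_trans/(_ xb); rewrite innerZr conjcR rnormM rnormR.
by rewrite gtr0_norm// lee_fin mulrC ler_pdivrMr 1?mulrC// lt_def c00.
Qed.

Lemma hull_snorm x y c : (snorm V y <= c%:E)%E -> hull x ->
  rnorm (inner x y) <= c.
Proof.
move=> /snorm_leP yc hx.
have lin : linear (fun x => inner x y).
  by move=> a u v; rewrite innerDl innerZl.
apply: (hull_le lin _ _ hx) => [|v Vv]; first exact: continuous_inner.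
by rewrite rnorm_innerC yc.
Qed.

(** * Entanglement of vector states *)

Lemma op_snorm_hull X x y : (op_snorm V X <= 1)%E -> hull x -> hull y ->
  rnorm (inner (X x) y) <= 1.
Proof.
move=> X1 hx hy.
have XV u v : V u -> V v -> rnorm (inner (X u) v) <= 1.
  move=> Vu Vv; rewrite -lee_fin (le_trans _ X1)//.
  by apply: ereal_sup_ubound; exists u => //; exists v.
(* The bound is extended from [V] to the hull one variable at a time: in [y] by [hull_snorm], then
   in [x] with [v] fixed in [V]. *)
rewrite rnorm_innerC; apply: hull_snorm hy; apply/snorm_leP => v Vv.
have lin : linear (fun x => inner (X x) v).
  by move=> a u w; rewrite bop_linear innerDl innerZl.
apply: (hull_le lin _ _ hx) => [u|u Vu]; last exact: XV.
apply: (@continuous_comp _ _ _ X (fun x => inner x v)).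
  exact: continuous_bop.
exact: continuous_inner.
Qed.

(** [b^-1 x] lies in the hull, and [<X x, x>] scales quadratically in [x]. *)
Lemma entanglement_vector_state_le x b : 0 < b -> (dual_norm V x <= b%:E)%E ->
  (entanglement V (vector_state x) <= (b ^+ 2)%:E)%E.
Proof.
move=> b0 /(dual_norm_hull b0) hx; apply: ge_ereal_sup => _ [X [_ /= X1] <-].
have := op_snorm_hull X1 hx hx.
rewrite (GRing.scalable_linear (bop_linear X)) innerZl innerZr conjcR !rnormM.
rewrite rnormR gtr0_norm ?invr_gt0// mulrA -invfM mulrC lee_fin.
by rewrite ler_pdivrMr ?mul1r ?expr2// mulr_gt0.
Qed.

(** [rank1 y] takes the value [|<x, y>|^2] in the state of [x], and [||rank1 y||_V <= 1] because its
    matrix elements on [V] are products of two factors at most 1. *)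
Lemma entanglement_vector_state_ge x y : (snorm V y <= 1)%E ->
  ((rnorm (inner x y) ^+ 2)%:E <= entanglement V (vector_state x))%E.
Proof.
move=> y1; apply: ereal_sup_ubound; exists (rank1 y).
  split=> /=; first exact: rank1_compacts_plus_scalars.
  apply: ge_ereal_sup => _ [u Vu [v Vv <-]].
  move/snorm_leP : y1 => y1; rewrite innerZl rnormM lee_fin rnorm_innerC.
  by rewrite mulr_ile1 ?rnorm_ge0 ?y1.
by rewrite /vector_state /= innerZl rnormM (rnorm_innerC y) expr2.
Qed.

Lemma entanglement_vector_state x : rnorm x = 1 ->
  entanglement V (vector_state x) = (dual_norm V x ^+ 2)%E.
Proof.
move=> x1; apply/eqP; rewrite eq_le; apply/andP; split.
  case: (dual_norm V x) (dual_norm_ge1 x1) (@entanglement_vector_state_le x).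
  - move=> b b1 /(_ b); apply => //.
    by rewrite (lt_le_trans _ (_ : 1 <= b)).
  - by move=> _ _; rewrite expe2 mulyy leey.
  - by [].
have E0 y := @entanglement_vector_state_ge x y.
(* This excludes the value [-oo]; for [+oo] the inequality is trivial, and a finite value [e] bounds
   every [|<x, y>|] by its square root. *)
have : (1 <= entanglement V (vector_state x))%E.
  have := E0 x; rewrite inner_rnorm rnormR x1 !expr1n normr1 expr1n; apply.
  by apply: le_trans (snorm_le_rnorm _) _; rewrite x1.
case: (entanglement V (vector_state x)) E0 => [e E0 e1|_ _|//]; last first.
  by rewrite leey.
have e0 : 0 <= e by rewrite (le_trans _ (_ : 1 <= e)).
have : (dual_norm V x <= (Num.sqrt e)%:E)%E.
  apply: ge_ereal_sup => _ [y /= y1 <-]; rewrite lee_fin.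
  rewrite -[X in X <= _]ger0_norm ?rnorm_ge0// -sqrtr_sqr ler_sqrt//.
  by have := E0 y y1; rewrite lee_fin.
case: (dual_norm V x) (dual_norm_ge0 x) => [d|//|//].
rewrite lee_fin => d0; rewrite lee_fin => de; rewrite -EFin_expe lee_fin.
by rewrite -(sqr_sqrtr e0) ler_sqr ?nnegrE ?sqrtr_ge0.
Qed.

(** * The inner radius by duality *)

Let radii := [set r | 0 <= r /\ [set x | rnorm x <= r] `<=` hull].

(** The multiple of [y] of norm [r] lies in the hull, and its pairing with [y] is [r |y|]. *)
Lemma radii_le r y c : radii r -> (snorm V y <= c%:E)%E -> r * rnorm y <= c.
Proof.
move=> [r0 rhull] yc.
have [y0|y0] := eqVneq (rnorm y) 0.
  by rewrite y0 mulr0 -lee_fin (le_trans (snorm_ge0 y)).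
have y_gt0 : 0 < rnorm y by rewrite lt_def y0 rnorm_ge0.
have ry0 : 0 <= r / rnorm y by rewrite divr_ge0 ?rnorm_ge0.
have : hull ((r / rnorm y)%:C *: y).
  by apply: rhull => /=; rewrite rnormZ rnormR ger0_norm// divfK.
move=> /(hull_snorm yc); rewrite innerZl inner_rnorm rnormM !rnormR.
by rewrite !ger0_norm ?sqr_ge0// expr2 mulrA divfK.
Qed.

(** Converse of [radii_le], by Cauchy-Schwarz and [polar_hull]: the radii are exactly the [r >= 0]
    with [r |y| <= ||y||_V] for all [y]. *)
Lemma radiiP r : 0 <= r ->
  (forall y c, (snorm V y <= c%:E)%E -> r * rnorm y <= c) -> radii r.
Proof.
move=> r0 rV; split=> // x /= xr; apply: polar_hull => y c yc.
rewrite (le_trans (cauchy_schwarz _ _))// (le_trans _ (rV _ _ yc))//.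
by rewrite ler_wpM2r ?rnorm_ge0.
Qed.

Lemma unit_vector : exists u : H, rnorm u = 1.
Proof.
have [x x0] := H_neq0.
have nx0 : rnorm x != 0 by apply: contra_neq x0 => /rnorm0_eq0.
exists ((rnorm x)^-1%:C *: x).
by rewrite rnormZ rnormR ger0_norm ?invr_ge0 ?rnorm_ge0// mulVf.
Qed.

Lemma has_sup_radii : has_sup radii.
Proof.
split.
  exists 0; apply: radiiP => // y c yc.
  by rewrite mul0r -lee_fin (le_trans (snorm_ge0 y)).
exists 1 => r rV; have [u u1] := unit_vector.
have := radii_le rV (snorm_le_rnorm u).
by rewrite u1 mulr1.
Qed.

Lemma inner_radius_snorm y c : (snorm V y <= c%:E)%E ->
  inner_radius V * rnorm y <= c.
Proof.
move=> yc; have [y0|y0] := eqVneq (rnorm y) 0.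
  by rewrite y0 mulr0 -lee_fin (le_trans (snorm_ge0 y)).
have y_gt0 : 0 < rnorm y by rewrite lt_def y0 rnorm_ge0.
rewrite -ler_pdivlMr//; apply: ge_sup; first exact: has_sup_radii.1.
by move=> r rV; rewrite ler_pdivlMr//; exact: radii_le.
Qed.

Lemma le_inner_radius r : 0 <= r ->
  (forall y c, (snorm V y <= c%:E)%E -> r * rnorm y <= c) ->
  r <= inner_radius V.
Proof. by move=> r0 rV; apply: (ub_le_sup has_sup_radii.2); exact: radiiP. Qed.

(** * Distance to [V] and maximal vectors *)

Lemma sqr_rnormB_unit x v : rnorm x = 1 -> V v ->
  rnorm (x - v) ^+ 2 = 2 - 2 * complex.Re (inner x v).
Proof. by move=> x1 Vv; rewrite sqr_rnormB x1 (V_unit Vv) expr1n; ring. Qed.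

Let N x := fine (snorm V x).

Lemma N_le1 x : rnorm x = 1 -> N x <= 1.
Proof. by move=> x1; rewrite -lee_fin -snormE -x1 snorm_le_rnorm. Qed.

(** The squared distance from [x] to [v] is [2 - 2 Re <x, v>]. Since [V] is circled, the supremum of
    [Re <x, v>] over [V] is [||x||_V]. *)
Lemma dist_unit x : rnorm x = 1 -> dist V x = (Num.sqrt (2 - 2 * N x))%:E.
Proof.
move=> x1; have N1 := N_le1 x1.
have N0 : 0 <= 2 - 2 * N x by lra.
have := lexx (snorm V x); rewrite {2}snormE => /snorm_leP xN.
have ge_dist : ((Num.sqrt (2 - 2 * N x))%:E <= dist V x)%E.
  apply: le_ereal_inf_tmp => _ [v Vv <-]; rewrite lee_fin.
  rewrite -[leRHS]ger0_norm ?rnorm_ge0// -sqrtr_sqr ler_sqrt ?sqr_ge0//.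
  rewrite sqr_rnormB_unit//.
  by have := le_trans (Re_le_rnorm _) (xN v Vv); rewrite -/(N x); lra.
apply/eqP; rewrite eq_le ge_dist andbT.
have le_dist v : V v -> (dist V x <= (rnorm (x - v))%:E)%E.
  by move=> Vv; apply: ereal_inf_lbound; exists v.
case: (dist V x) ge_dist le_dist => [d||]//; last first.
  by move=> _; have [v0 Vv0] := V_neq0 => /(_ v0 Vv0).
rewrite !lee_fin => Nd dV.
have d0 : 0 <= d := le_trans (sqrtr_ge0 _) Nd.
rewrite -[d]ger0_norm// -sqrtr_sqr ler_sqrt//.
suff : (snorm V x <= (1 - d ^+ 2 / 2)%:E)%E by rewrite snormE lee_fin -/(N x); lra.
apply/snorm_leP => v Vv.
have [l l1 <-] := rotate_to_rnorm (inner x v).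
(* The conjugate phase is used because the inner product is conjugate-linear in its second
   argument. *)
have Vlv : V (l^* *: v) by apply: V1; rewrite ?rnormJ.
have := dV _ Vlv; rewrite lee_fin -ler_sqr ?nnegrE ?rnorm_ge0//.
by rewrite sqr_rnormB_unit// innerZr conjCK; lra.
Qed.

(** By [dist_unit] the distance decreases as [||x||_V] grows, so maximal vectors minimise [||.||_V]
    on the unit sphere. The infimum there is the inner radius. *)
Lemma maximal_vectorP x : rnorm x = 1 ->
  maximal_vector V x <-> (snorm V x <= (inner_radius V)%:E)%E.
Proof.
move=> x1; have Nx0 : 0 <= N x by rewrite fine_ge0 ?snorm_ge0.
have distE y : rnorm y = 1 -> (dist V y <= dist V x)%E = (N x <= N y).
  move=> y1; rewrite !dist_unit// lee_fin ler_sqrt; last first.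
    by have := N_le1 x1; lra.
  by apply/idP/idP; lra.
split=> [[_ xmax]|xr].
  (* Normalising [y] shows that [N x] is itself an admissible radius. *)
  rewrite snormE lee_fin; apply: le_inner_radius => // y c yc.
  have [y0|y0] := eqVneq (rnorm y) 0.
    by rewrite y0 mulr0 -lee_fin (le_trans (snorm_ge0 y)).
  have y_gt0 : 0 < (rnorm y)^-1 by rewrite invr_gt0 lt_def y0 rnorm_ge0.
  have u1 : rnorm ((rnorm y)^-1%:C *: y) = 1.
    by rewrite rnormZ rnormR gtr0_norm// mulVf.
  have : N x <= N ((rnorm y)^-1%:C *: y).
    by rewrite -distE// xmax; apply: ereal_sup_ubound; exists ((rnorm y)^-1%:C *: y).
  move=> /le_trans; rewrite -ler_pdivlMr -?[_ < rnorm y]invr_gt0//; apply.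
  rewrite mulrC -lee_fin -snormE -[X in (X * c)%:E]gtr0_norm// -rnormR.
  exact: snormZ_le.
split=> //; apply/eqP; rewrite eq_le; apply/andP; split.
  by apply: ereal_sup_ubound; exists x.
apply: ge_ereal_sup => _ [y /= y1 <-]; rewrite distE// -lee_fin -snormE.
apply: (le_trans xr); rewrite lee_fin -[inner_radius V]mulr1 -y1.
by apply: inner_radius_snorm; rewrite -snormE.
Qed.

(** * Maximal entanglement when the inner radius is positive *)

Context (r_gt0 : 0 < inner_radius V).
Let r := inner_radius V.

Lemma rnorm_le_inv_radius y : (snorm V y <= 1)%E -> rnorm y <= r^-1.
Proof.
by move=> /inner_radius_snorm; rewrite -ler_pdivlMl// mulr1.
Qed.

Lemma dual_norm_le_inv_radius x : rnorm x = 1 -> (dual_norm V x <= r^-1%:E)%E.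
Proof.
move=> x1; apply: ge_ereal_sup => _ [y /= y1 <-]; rewrite lee_fin.
rewrite (le_trans (cauchy_schwarz _ _))// x1 mul1r.
exact: rnorm_le_inv_radius.
Qed.

(* If the supremum defining the dual norm comes close to r^-1 at y, then, as
   |y| <= r^-1, y is close to r^-1 x; so ||r^-1 x||_V <= 1. *)
Lemma dual_norm_inv_radiusP x : rnorm x = 1 ->
  dual_norm V x = r^-1%:E <-> (snorm V x <= r%:E)%E.
Proof.
move=> x1; have ri0 : 0 < r^-1 by rewrite invr_gt0.
split=> [xr|xr]; last first.
  apply/eqP; rewrite eq_le dual_norm_le_inv_radius//=.
  (* The test vector [r^-1 x] attains the upper bound [r^-1]. *)
  apply: le_trans (@dual_norm_ge x (r^-1%:C *: x) _).
    by rewrite innerZr conjcR rnormM inner_rnorm !rnormR x1 expr1n normr1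
      mulr1 gtr0_norm.
  have := snormZ_le r^-1%:C xr.
  by rewrite rnormR gtr0_norm// mulVf// gt_eqF.
apply/snorm_leP => v Vv; rewrite -[leRHS]mulr1 -ler_pdivrMl//.
apply/ler_addgt0Pr => e e0.
(* With this tolerance the expansion of [|r^-1 x - z|^2] below is at most
   [2 r^-2 - 2 r^-1 (r^-1 - e^2 r / 2) = e^2]. *)
have e20 : 0 < e ^+ 2 * r / 2 by rewrite divr_gt0// mulr_gt0// exprn_gt0.
have [] := @ub_ereal_sup_adherent _ [set (rnorm (inner x y))%:E
    | y in [set y | (snorm V y <= 1)%E]] _ e20.
  by rewrite -[ereal_sup _]/(dual_norm V x) xr.
rewrite -[ereal_sup _]/(dual_norm V x) xr => _ [y /= y1 <-].
have [l l1 lxy] := rotate_to_rnorm (inner x y).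
rewrite -EFinB lte_fin -lxy -[l]conjCK -innerZr.
set z := l^* *: y => xz.
have z1 : (snorm V z <= 1)%E.
  by have := snormZ_le l^* y1; rewrite rnormJ l1 mul1r.
have zr := rnorm_le_inv_radius z1.
have : rnorm (r^-1%:C *: x - z) <= e.
  rewrite -ler_sqr ?nnegrE ?rnorm_ge0 ?(ltW e0)//.
  rewrite sqr_rnormB rnormZ rnormR x1 mulr1 innerZl ReZ gtr0_norm//.
  have : rnorm z ^+ 2 <= r^-1 ^+ 2 
    by rewrite ler_sqr ?nnegrE ?rnorm_ge0 ?(ltW ri0).
  move: xz => /ltW/(ler_wpM2l (ltW ri0)); rewrite mulrBr.
  have -> : r^-1 * (e ^+ 2 * r / 2) = e ^+ 2 / 2 by field; rewrite gt_eqF.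
  by rewrite -expr2; lra.
move=> xze; have := (snorm_leP _ _).1 z1 v Vv.
have -> : r^-1 * rnorm (inner x v) = rnorm (inner (r^-1%:C *: x) v).
  by rewrite innerZl rnormM rnormR gtr0_norm.
(* The part along [z] contributes at most 1 and the remainder at most [e]. *)
rewrite -[r^-1%:C *: x](subrK z) innerDl => zv.
rewrite (le_trans (ler_rnormD _ _))// addrC lerD//.
by rewrite (le_trans (cauchy_schwarz _ _))// (V_unit Vv) mulr1.
Qed.

Lemma entanglement_unit_le x : rnorm x = 1 ->
  (entanglement V (vector_state x) <= (r^-1 ^+ 2)%:E)%E.
Proof.
move=> x1; apply: entanglement_vector_state_le; first by rewrite invr_gt0.
exact: dual_norm_le_inv_radius.
Qed.

(** For a nonzero radius the extended inverse is the real one. *)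
Lemma maximally_entangledP (rho : bop H -> R[i]) : maximally_entangled V rho <->
  normal_state rho /\ entanglement V rho = (r^-1 ^+ 2)%:E.
Proof. by rewrite /maximally_entangled inver gt_eqF// -EFin_expe. Qed.

Lemma maximally_entangled_vector_stateP x : rnorm x = 1 ->
  maximally_entangled V (vector_state x) <-> maximal_vector V x.
Proof.
move=> x1; rewrite maximally_entangledP maximal_vectorP//.
rewrite -dual_norm_inv_radiusP// entanglement_vector_state//.
split=> [[_]|->]; last by split; [exact: normal_state_vector_state|].
have := dual_norm_le_inv_radius x1; have := dual_norm_ge0 x.
case: (dual_norm V x) => [d||]// d0 _; rewrite -EFin_expe => -[/eqP].
by rewrite lee_fin in d0; rewrite eqrXn2 ?invr_ge0 ?(ltW r_gt0)// => /eqP ->.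
Qed.

(** If component [k] had entanglement [q < m = r^-2], its weight would pull every [|rho X|] down to
    [m - t_k (m - q)], which is below [m]. *)
Lemma component_maximally_entangled (rho : bop H -> R[i])
    (D : set nat) (t : nat -> R) (xi : nat -> H) (k : nat) :
    maximally_entangled V rho ->
    (forall k, D k -> 0 < t k) ->
    \sum_(0 <= k < n | k \in D) t k @[n --> \oo] --> (1 : R) ->
    (forall k, D k -> rnorm (xi k) = 1) ->
    (forall X : bop H,
      \sum_(0 <= k < n | k \in D) (t k)%:C * vector_state (xi k) X
        @[n --> \oo] --> rho X) ->
    D k -> maximally_entangled V (vector_state (xi k)).
Proof.
move=> /maximally_entangledP[_ Erho] t0 t1 xi1 rhoE Dk.
apply/maximally_entangledP; split; first exact/normal_state_vector_state/xi1.
apply/eqP; rewrite eq_le entanglement_unit_le ?xi1//=.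
rewrite -Erho leNgt; apply/negP => Ek_lt.
have Ek_ge0 : (0 <= entanglement V (vector_state (xi k)))%E.
  by rewrite entanglement_vector_state ?xi1// sqre_ge0.
move: Ek_lt Ek_ge0.
set m := r^-1 ^+ 2 in Erho *; rewrite Erho.
case Ek : (entanglement V _) => [q||]//; rewrite lte_fin => qm _.
have Em j X : D j ->
    (compacts_plus_scalars `&` [set X | (op_snorm V X <= 1)%E]) X ->
    rnorm (vector_state (xi j) X) <= m.
  move=> Dj HX; rewrite -lee_fin (le_trans _ (entanglement_unit_le (xi1 _ Dj)))//.
  by apply: ereal_sup_ubound; exists X.
have Eq X : (compacts_plus_scalars `&` [set X | (op_snorm V X <= 1)%E]) X ->
    rnorm (vector_state (xi k) X) <= q.
  move=> HX; rewrite -lee_fin -Ek.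
  by apply: ereal_sup_ubound; exists X.
suff : (entanglement V rho <= (m - t k * (m - q))%:E)%E.
  rewrite Erho lee_fin; apply/negP; rewrite -ltNge ltrBlDr ltrDl.
  by rewrite mulr_gt0 ?t0// subr_gt0.
apply: ge_ereal_sup => _ [X HX <-]; rewrite lee_fin.
(* The termwise majorant: weight times [m], with the deficit of component [k] removed. *)
have cl : \sum_(0 <= j < n | j \in D) t j * m - t k * (m - q)
    @[n --> \oo] --> m - t k * (m - q).
  apply: cvgB; last exact: cvg_cst.
  rewrite -[X in _ --> X]mul1r.
  under eq_fun do rewrite -mulr_suml.
  by apply: cvgM => //; exact: cvg_cst.
apply: (ler_cvg_to (cvg_rnorm (rhoE X)) cl); near=> n.
(* Only partial sums that already contain the index [k] show the deficit. *)
have kn : (k < n)%N by near: n; exact: nbhs_infty_gt.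
rewrite (le_trans (ler_rnorm_sum _ _ _))//.
rewrite -(sum_indicator (t k * (m - q)) Dk kn) -sumrB.
apply: ler_sum => j; rewrite inE => Dj.
rewrite rnormM rnormR gtr0_norm ?t0//.
have [->|jk] := eqVneq j k.
  by have := ler_wpM2l (ltW (t0 _ Dk)) (Eq X HX); lra.
by rewrite subr0 ler_wpM2l ?(ltW (t0 _ Dj))// Em.
Unshelve. all: by end_near. Qed.

End EntanglingSet.

Theorem theorem7p2 (R : realType) (H : hilbertType R) (V : set H)
    (H_neq0 : exists x : H, x != 0)
    (V_unit : forall x, V x -> rnorm x = 1)
    (V_closed : closed V)
    (V1 : forall (l : R[i]) x, rnorm l = 1 -> V x -> V (l *: x))
    (V2 : forall x : H, (forall y, V y -> inner x y = 0) -> x = 0)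
    (xi : H) (xi_unit : rnorm xi = 1) :
  entanglement V (vector_state xi) = (dual_norm V xi ^+ 2)%E /\
  (0 < inner_radius V ->
    (maximally_entangled V (vector_state xi) <-> maximal_vector V xi) /\
    (forall rho : bop H -> R[i], maximally_entangled V rho ->
      (* D indexes a finite or countably infinite convex combination *)
      forall (D : set nat) (t : nat -> R) (xi_ : nat -> H),
        (forall k, D k -> 0 < t k) ->
        \sum_(0 <= k < n | k \in D) t k @[n --> \oo] --> (1 : R) ->
        (forall k, D k -> rnorm (xi_ k) = 1) ->
        (forall X : bop H,
          \sum_(0 <= k < n | k \in D) (t k)%:C * vector_state (xi_ k) X
            @[n --> \oo] --> rho X) ->
        forall k, D k -> maximally_entangled V (vector_state (xi_ k)))).
Proof.
split; first exact: entanglement_vector_state.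
move=> r_gt0; split; first exact: maximally_entangled_vector_stateP.
move=> rho rho_max D t xi_ t0 t1 xi1 rhoE k.
exact: (component_maximally_entangled _ _ _ _ r_gt0 rho_max t0 t1 xi1 rhoE).
Qed.
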